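(* Let $n,k$ be integers with $2\le k\le n/2$, and let $\varnothing\subsetneq J\subsetneq[n]$ be a subset of size $t$ with cyclic differences $d_1,\dots,d_t$. Then $$\bigl|\{T\in\mathrm{SYT}(n-k,k): \mathrm{cDes}(T)=J\}\bigr| = [q^{k}]\left(\prod_{i=1}^{t}\sum_{j=1}^{d_i-1}q^j\right)-[q^{k-1}]\left(\prod_{i=1}^{t}\sum_{j=1}^{d_i-1}q^j\right),$$ where $[q^r]f$ denotes the coefficient of $q^r$ in the polynomial $f$.
   Context: Let $[n]=\{1,\dots,n\}$. $\mathrm{SYT}(n-k,k)$ is the set of standard Young tableaux of shape $(n-k,k)$ in English notation (row 1 on top); $T_{i,j}$ is the entry in row $i$, column $j$; $\mathrm{Des}(T)=\{i\in[n-1]:i+1\text{ is in a lower row than }i\text{ in }T\}$. The cyclic descent map on $\mathrm{SYT}(n-k,k)$, $2\le k\le n/2$, is defined by $\mathrm{cDes}(T)\cap[n-1]=\mathrm{Des}(T)$ and: $n\in\mathrm{cDes}(T)$ if and only if both (1) $T_{2,k}=T_{2,k-1}+1$ and (2) $T_{2,i-1}>T_{1,i}$ for every $1<i<k$. For a nonempty subset $J=\{j_1<\dots<j_t\}\subseteq[n]$, its cyclic differences are $d_1:=j_1-j_t+n$ and $d_i:=j_i-j_{i-1}$ for $2\le i\le t$. An empty sum is $0$. *)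

(* Defs.v *)
From mathcomp Require Import all_boot all_order all_algebra.
Set Implicit Arguments.
Unset Strict Implicit.
Unset Printing Implicit Defensive.

Local Open Scope nat_scope.

(* The set {1, ..., n}; subsets of it are subsets of 'I_n.+1 avoiding 0, so
   that elements keep their usual values. *)
Definition brk n : {set 'I_n.+1} := [set i : 'I_n.+1 | 0 < i].

(* Fillings of the shape (n - k, k): the pair (row 1, row 2). *)
Definition tableau n k : finType :=
  ((n - k).-tuple 'I_n.+1 * k.-tuple 'I_n.+1)%type.

Section Tableau.
Variables n k : nat.
Implicit Type T : tableau n k.

Definition row T (i : nat) : seq nat :=
  if i == 1 then [seq val x | x <- T.1] else [seq val x | x <- T.2].

(* T_{i,j}, with i and j counted from 1. *)
Definition entry T (i j : nat) : nat := nth 0 (row T i) j.-1.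

Definition SYT : {set tableau n k} :=
  [set T : tableau n k |
    [&& perm_eq (row T 1 ++ row T 2) (iota 1 n),
        sorted ltn (row T 1),
        sorted ltn (row T 2)
      & [forall j : 'I_k.+1,
           (0 < j <= n - k) && (j <= k) ==> (entry T 1 j < entry T 2 j)]]].

Definition row_of T (m : nat) : nat := if m \in row T 1 then 1 else 2.

Definition Des T : {set 'I_n.+1} :=
  [set i : 'I_n.+1 | (0 < i < n) && (row_of T i < row_of T i.+1)].

Definition n_is_cdes T : bool :=
  (entry T 2 k == entry T 2 k.-1 + 1) &&
  [forall i : 'I_k, (1 < i) ==> (entry T 1 i < entry T 2 i.-1)].

Definition cDes T : {set 'I_n.+1} :=
  Des T :|: (if n_is_cdes T then [set ord_max] else set0).

End Tableau.

(* For J = {j_1 < ... < j_t}, elt J i is j_i (i counted from 1); [enum] lists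
   a set of ordinals in increasing order. *)
Definition elt n (J : {set 'I_n.+1}) (i : nat) : nat :=
  nth 0 [seq val x | x <- enum J] i.-1.

Lemma enum_set_sorted n (J : {set 'I_n.+1}) :
  sorted ltn [seq val x | x <- enum J].
Proof.
have: sorted ltn [seq val x | x <- enum 'I_n.+1].
  by rewrite val_enum_ord iota_ltn_sorted.
rewrite /enum_mem (eq_filter (a2 := xpredT)) ?filter_predT // !sorted_map.
by apply: sorted_filter => x y z /=; apply: ltn_trans.
Qed.

(* In d_1 = j_1 - j_t + n the terms are reordered to avoid truncated
   subtraction. *)
Definition cdiff n (J : {set 'I_n.+1}) (i : nat) : nat :=
  if i == 1 then elt J 1 + n - elt J #|J| else elt J i - elt J i.-1.

Definition cdiff_poly n (J : {set 'I_n.+1}) : {poly int} :=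
  (\prod_(1 <= i < #|J|.+1) \sum_(1 <= j < cdiff J i) 'X^j)%R.

(* Main.v *)
Require Import Defs.
From mathcomp Require Import all_boot all_order all_algebra.
From mathcomp Require Import zify ring.
Set Implicit Arguments.
Unset Strict Implicit.
Unset Printing Implicit Defensive.
Import GRing.Theory.

(** Record a tableau as a word in two letters, U for an entry of row 1 and D
for an entry of row 2. Standard tableaux become ballot words (no prefix has
more D than U) and a descent at [i] becomes a U at [i] followed by a D.

For nonempty [J], the polynomial [cdiff_poly J] is the generating function, by
number of D, of all words of length [n] whose cyclic descent set is [J]: each cyclic
block between consecutive elements of [J] reads D..DU..U with both parts
nonempty. So the theorem says that the words with [k] letters D, minus those
with [k - 1], are equinumerous with the tableaux. Taking the difference of
consecutive coefficients amounts to multiplying by [1 - 'X].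

The linear version of this is the reflection principle: for [2 * r <= n], the
ballot words with [r] letters D and linear descent set [J] are as many as all
such words with [r] letters D minus those with [r - 1]
([num_ballots_transfer], [count_ballots]). Both sides satisfy the same
letter-by-letter recursion; they could differ only at the boundary
[2 * r = n + 1], where the ballot side vanishes by definition and the other
side vanishes because the generating function of all words is palindromic
([transfer_palindrome]).

The cyclic version reduces to the linear one. A tableau with a cyclic descent
at [n] has a word U v DD U..U in which v D is a ballot word
([cyclic_word_rows]). Sending it to the ballot word y = v D U..U, of length
[n - 2] with [k - 1] letters D, is a bijection which only shifts the descents
([count_cyclic_word]). On the side of all words, those with a cyclic descent
at [n] are the words D x U with x arbitrary of length [n - 2]
([transfer_lower_start]), so the linear version in length [n - 2] settles
every [J] containing [n]. When [n] is not in [J], the words and the tableaux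
with linear descent set [J] split according to whether [n] is a cyclic
descent, and the result follows by subtraction ([cdiff_poly_in],
[cdiff_poly_notin]). *)

(** * Words and their descents *)

(** A word is listed from its last letter to its first, with [true] for D, so
that adding a letter at the end of the word, hence an entry to a tableau, is a
[cons]. *)
Fixpoint words n : seq bitseq :=
  if n is m.+1 then map (cons false) (words m) ++ map (cons true) (words m)
  else [:: [::]].

Lemma mem_words n u : (u \in words n) = (size u == n).
Proof.
elim: n u => [|n IHn] [|a u]; rewrite ?inE //= mem_cat.
  by apply/negbTE/norP; split; apply/mapP => -[].
rewrite eqSS -IHn; apply/orP/idP => [[]/mapP[v Hv [_ ->]] // | Hu].
by case: a; [right | left]; apply: map_f.
Qed.

Lemma uniq_words n : uniq (words n).
Proof.
elim: n => //= n IHn; rewrite cat_uniq !map_inj_uniq ?IHn; try by move=> x y [].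
by rewrite andbT; apply/hasPn => _ /mapP[v _ ->]; apply/mapP => -[].
Qed.

(** Since words are listed backwards, the letter just below the head [a] of
[a :: v] is letter number [size v]; this tests that the descents between 1 and
the length minus 1 are exactly the positions in [J]. *)
Fixpoint descents_at (J : pred nat) (u : bitseq) : bool :=
  if u is a :: v then
    (if v is b :: _ then (~~ b && a) == J (size v) else true) && descents_at J v
  else true.

Lemma descents_at_cons J a v : v != [::] ->
  descents_at J (a :: v) =
  ((~~ head false v && a) == J (size v).-1.+1) && descents_at J v.
Proof. by case: v. Qed.

(** The suffixes of the list are the prefixes of the word. The offset [c] is 0
for ballot words and 1 for words that stay strictly ahead after each letter. *)
Fixpoint ballot c (u : bitseq) : bool :=
  if u is _ :: v then (2 * count id u + c <= size u) && ballot c v else true.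

Lemma ballot_count c u : u != [::] -> ballot c u -> 2 * count id u + c <= size u.
Proof. by case: u => //= a u _ /andP[]. Qed.

(** A final U cannot break the ballot condition. *)
Lemma ballot_false v : ballot 0 (false :: v) = ballot 0 v.
Proof.
case: v => // b v; rewrite /= !add0n !addn0.
by apply/andb_idl => /andP[]; lia.
Qed.

(** * Ballot words refined by last letter *)

Definition num_ballots J n h r :=
  count (fun u => [&& head false u == h, descents_at J u, ballot 0 u & count id u == r])
        (words n).

(** A final U makes no descent before it and cannot break the ballot condition,
so it can follow any word unless a descent is prescribed there. *)
Lemma num_ballots_upperS J m r :
  num_ballots J m.+2 false r =
  if J m.+1 then 0 else num_ballots J m.+1 false r + num_ballots J m.+1 true r.
Proof.
rewrite /num_ballots [words m.+2]/= count_cat !count_map addnC -/(words m.+1).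
rewrite (eq_count (a2 := pred0)) ?count_pred0; last by [].
rewrite add0n.
transitivity (count (fun u =>
    [&& ~~ J m.+1, descents_at J u, ballot 0 u & count id u == r]) (words m.+1)).
  apply: eq_in_count => u; rewrite mem_words => /eqP su.
  rewrite -[preim _ _ u]/[&& true, descents_at J (false :: u), ballot 0 (false :: u)
    & count id u == r] descents_at_cons -?size_eq0 ?su // ballot_false andbF.
  by rewrite [false == _]eq_sym eqbF_neg -!andbA.
case: (J _) => /=; first by rewrite count_pred0.
rewrite -count_predUI [X in (_ = _ + X)%N](eq_count (a2 := pred0)).
  by rewrite count_pred0 addn0; apply: eq_count => u /=;
    case: (head _ _); rewrite /= ?orbF.
by move=> u /=; case: (head _ _); rewrite ?andbF.
Qed.

Lemma num_ballots_lower0 J m : num_ballots J m.+2 true 0 = 0.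
Proof.
apply/eqP; rewrite -leqn0 leqNgt -has_count; apply/hasPn => u _.
by case: u => [|[] u] //=; rewrite add1n !andbF.
Qed.

(** A final D must follow U if a descent is prescribed before it and D
otherwise; the only ballot inequality to check is that of the whole word. *)
Lemma num_ballots_lowerS J m r :
  num_ballots J m.+2 true r.+1 =
  if 2 * r.+1 <= m.+2 then num_ballots J m.+1 (~~ J m.+1) r else 0.
Proof.
rewrite /num_ballots [words m.+2]/= count_cat !count_map -/(words m.+1).
rewrite (eq_count (a2 := pred0)) ?count_pred0; last by [].
transitivity (count (fun u => (2 * r.+1 <= m.+2) && [&& head false u == ~~ J m.+1,
    descents_at J u, ballot 0 u & count id u == r]) (words m.+1)).
  apply: eq_in_count => u; rewrite mem_words => /eqP su.
  rewrite -[preim _ _ u]/[&& true, descents_at J (true :: u), ballot 0 (true :: u)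
    & (count id u).+1 == r.+1] descents_at_cons -?size_eq0 ?su // andbT eqSS /=.
  case: (_ =P r) => [->|_]; rewrite ?andbF // !andbT su addn0 add1n.
  have -> : (~~ head false u == J m.+1) = (head false u == ~~ J m.+1).
    by case: (head _ _); case: (J _).
  by case: (head _ _ == _); case: (_ <= m.+2); rewrite ?andbF.
by case: (_ <= _) => //=; rewrite count_pred0.
Qed.

(** * Words of tableaux with a cyclic descent at n *)

(** Doubles the last D of the word, which is the first one met in the list. *)
Fixpoint double_first u : bitseq :=
  if u is a :: v then (if a then true :: u else false :: double_first v) else [::].

(** The inverse of the reduction of cyclic tableaux to shorter ballot words:
y = v D U..U is sent to U v DD U..U. *)
Definition cyclic_lift y := rcons (double_first y) false.

(** The words U v DD U..U with v D ballot. The strict ballot condition on the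
part up to the first of the two D forces the initial U and, by
[ballot_rcons_false], makes v D a ballot word. *)
Fixpoint cyclic_word u :=
  if u is a :: v then
    (if a then head false v && ballot 1 v else cyclic_word v)
  else false.

(** An initial U puts every prefix one step further ahead. *)
Lemma ballot_rcons_false z : ballot 1 (rcons z false) = ballot 0 z.
Proof.
elim: z => //= a z ->; congr (_ && _).
by rewrite size_rcons -cats1 count_cat /= !addn0 addn1 ltnS.
Qed.

Lemma ballot_rcons_true z c : ballot c (rcons z true) = false.
Proof. by elim: z => [|a z IHz] /=; rewrite ?IHz ?andbF //; case: c. Qed.

Lemma ballot1W u : ballot 1 u -> ballot 0 u.
Proof. by elim: u => //= a u IHu /andP[h /IHu ->]; rewrite andbT; lia. Qed.

Lemma ballot_last y : ballot 0 y -> last false y = false.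
Proof. by case/lastP: y => // z []; rewrite ?ballot_rcons_true ?last_rcons. Qed.

Lemma descents_at_rcons_false J z : z != [::] ->
  descents_at J (rcons z false) =
  (last false z == J 1) && descents_at (fun i => J i.+1) z.
Proof.
elim: z => // a [_ _|b z IHz _]; first by rewrite /= andbT.
rewrite rcons_cons descents_at_cons; last by case: (z).
rewrite IHz // [descents_at _ (_ :: _ :: _)]descents_at_cons // size_rcons.
by rewrite andbCA.
Qed.

Lemma size_double_first y : true \in y -> size (double_first y) = (size y).+1.
Proof. by elim: y => // -[] y IHy //=; rewrite inE /= => /IHy ->. Qed.

Lemma count_double_first y : true \in y -> count id (double_first y) = (count id y).+1.
Proof. by elim: y => // -[] y IHy //=; rewrite inE /= !add0n => /IHy ->. Qed.

Lemma last_double_first a y : last a (double_first y) = last a y.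
Proof. by elim: y a => // -[] y IHy //= a; rewrite IHy. Qed.

Lemma double_first_inj y z : double_first y = double_first z -> y = z.
Proof.
by elim: y z => [|[] y IHy] [|[] z] //=; [case=> -> | case=> /IHy ->].
Qed.

Lemma cyclic_lift_inj : injective cyclic_lift.
Proof. by move=> y z /rcons_inj[/double_first_inj]. Qed.

(** Doubling the last D adds no descent: it only adds one position, at the
very end up to a run of U, where no descent occurs. *)
Lemma descents_at_double_first J y : true \in y ->
  descents_at J (double_first y) = ~~ J (size y) && descents_at J y.
Proof.
elim: y => // -[] y IHy.
  move=> _; rewrite -[LHS]/((false == J (size y).+1) && descents_at J (true :: y)).
  by case: (J _).
rewrite inE /= => hy.
have y0 : y != [::] by case: (y) hy.
have dy0 : double_first y != [::] by case: (y) hy => // -[].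
rewrite -[LHS]/(descents_at J (false :: double_first y)).
rewrite -[RHS]/(~~ J (size y).+1 && descents_at J (false :: y)).
rewrite !descents_at_cons // size_double_first // IHy // !andbF /=.
rewrite !(eq_sym false) !eqbF_neg.
by case: y y0 {hy dy0 IHy} => //= a y _; rewrite -andbA.
Qed.

Lemma cyclic_lift_spec y (y1 : true \in y) :
  [/\ size (cyclic_lift y) = (size y).+2, count id (cyclic_lift y) = (count id y).+1,
      cyclic_word (cyclic_lift y) = ballot 0 y
    & ballot 0 y -> ballot 0 (cyclic_lift y)].
Proof.
split.
- by rewrite size_rcons size_double_first.
- by rewrite /cyclic_lift -cats1 count_cat /= !addn0 count_double_first.
- elim: y y1 => // -[] y IHy; last first.
    by rewrite inE /= => hy; rewrite -[RHS]/(ballot 0 (false :: y)) ballot_false -IHy.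
  by move=> _; rewrite -(ballot_rcons_false (true :: y)).
elim: y y1 => // -[] y IHy; last first.
  rewrite inE ballot_false -[cyclic_lift _]/(false :: cyclic_lift y).
  by rewrite ballot_false; exact: IHy.
rewrite -ballot_rcons_false => _ h; have := ballot1W h; move: h.
rewrite -[cyclic_lift _]/(true :: rcons (true :: y) false).
move: (size_rcons (true :: y) false); move: (rcons _ _) => [|a u] // _ h0 h1 /=.
move: (h1) => /= ->.
by move: h0 => /= /andP[]; lia.
Qed.

Lemma descents_at_cyclic_lift J y : true \in y -> ballot 0 y ->
  descents_at J (cyclic_lift y)
  = [&& ~~ J 1, ~~ J (size y).+1 & descents_at (fun i => J i.+1) y].
Proof.
move=> y1 by0; rewrite descents_at_rcons_false; last by case: y y1 {by0} => // -[].
by rewrite last_double_first ballot_last // descents_at_double_first // eq_sym eqbF_neg.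
Qed.

Lemma cyclic_liftP u : cyclic_word u -> exists2 y, true \in y & u = cyclic_lift y.
Proof.
elim: u => // -[] u IHu /=; last first.
  by case/IHu => y y1 ->; exists (false :: y); rewrite ?inE.
case/andP; case/lastP: u {IHu} => // z [] h; rewrite ?ballot_rcons_true // => _.
case: z h => // -[] // z _; exists (true :: z) => //.
Qed.

(** Via [cyclic_lift], cyclic ballot words correspond to ballot words that are
two letters shorter. Their first descent cannot be at 1, as the second letter
is U, nor can the last be at the length minus 1, as a final D is preceded by
another D. *)
Lemma count_cyclic_word J m k :
  count (fun u => [&& cyclic_word u, descents_at J u, ballot 0 u & count id u == k.+2])
        (words m.+3)
  = if J 1 || J m.+2 then 0 else
    count (fun y =>
      [&& descents_at (fun i => J i.+1) y, ballot 0 y & count id y == k.+1])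
      (words m.+1).
Proof.
set P := fun u => _; set Q := fun y => _.
have mem1 y : count id y == k.+1 -> true \in y.
  by move=> /eqP E; rewrite -has_pred1 has_count (eq_count (a2 := id)) ?E //; case.
transitivity (count (fun y => ~~ (J 1 || J m.+2) && Q y) (words m.+1)); last first.
  by case: (_ || _) => /=; rewrite ?count_pred0.
rewrite -!size_filter -[RHS](size_map cyclic_lift); apply/perm_size/uniq_perm.
- exact/filter_uniq/uniq_words.
- by rewrite map_inj_uniq ?filter_uniq ?uniq_words //; apply: cyclic_lift_inj.
move=> u; rewrite mem_filter mem_words; apply/andP/mapP.
  case=> /and4P[hc hd hb hk] hs; have [y y1 Eu] := cyclic_liftP hc.
  have [ss sk sc _] := cyclic_lift_spec y1.
  exists y => //; rewrite mem_filter mem_words.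
  move: hc hd hb hk hs; rewrite Eu ss sk sc => by0.
  rewrite descents_at_cyclic_lift // => /and3P[J1 J2 hd] _ hk hs.
  move: hs J2; rewrite !eqSS => /eqP -> J2.
  by rewrite eqxx andbT negb_or J1 J2 /Q hd by0 -eqSS.
case=> y; rewrite mem_filter mem_words -andbA negb_or.
case/and3P=> /andP[J1 J2] /and3P[hd by0 hk] /eqP hs ->.
have y1 := mem1 _ hk; have [ss sk sc sb] := cyclic_lift_spec y1.
split; rewrite ?ss ?hs // /P sk sc by0 sb // eqSS hk.
by rewrite descents_at_cyclic_lift // hs J1 J2 hd.
Qed.

(** * Two-row tableaux as ballot words *)

Lemma nth_ltn_mono (s : seq nat) : sorted ltn s ->
  {in [pred i | (i < size s)] &, {mono nth 0 s : i j / (i < j)}}.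
Proof. by move=> hs; exact: (Order.POrderTheory.lt_sorted_ltn_nth 0 hs). Qed.

(** The word of the tableau whose second row is the set [A]. *)
Fixpoint word_of (A : pred nat) n : bitseq :=
  if n is m.+1 then A n :: word_of A m else [::].

Lemma size_word_of A n : size (word_of A n) = n.
Proof. by elim: n => //= n ->. Qed.

Lemma iota1S n : iota 1 n.+1 = rcons (iota 1 n) n.+1.
Proof. by rewrite -{1}[n.+1]addn1 iotaD cats1 add1n. Qed.

Lemma count_word_of A n : count id (word_of A n) = count A (iota 1 n).
Proof.
by elim: n => // n IHn; rewrite iota1S -cats1 count_cat /= IHn addn0 addnC.
Qed.

Lemma word_of_inj A B n : word_of A n = word_of B n -> {in iota 1 n, A =1 B}.
Proof.
elim: n => // n IHn [E /IHn h] m; rewrite iota1S mem_rcons inE.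
by case/orP => [/eqP -> | /h].
Qed.

Lemma word_of_surj u : exists A, u = word_of A (size u).
Proof.
elim: u => [|a u [A IHu]]; first by exists pred0.
exists (fun m => if m == (size u).+1 then a else A m) => /=.
rewrite eqxx {1}IHu; congr (_ :: _).
have : size u <= size u by []; elim: {1 3 5}(size u) => //= n IHn hn.
by rewrite IHn 1?ltnW // ltn_eqF.
Qed.

Lemma descents_at_word_of (J A : pred nat) n :
  reflect (forall m, 0 < m < n -> (~~ A m && A m.+1) = J m)
          (descents_at J (word_of A n)).
Proof.
elim: n => [|[|n] IHn]; [by left => m; lia | by left => m; lia |].
rewrite -[word_of _ _]/(A n.+2 :: word_of A n.+1) descents_at_cons //.
rewrite size_word_of /=; apply: (iffP andP) => [[/eqP hJ /IHn h] m hm | h].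
  by case: (ltnP m n.+1) => hmn; [apply: h; lia | have -> : m = n.+1 by lia].
by split; [apply/eqP/h; rewrite /= ltnSn | apply/IHn => m hm; apply: h; lia].
Qed.

(** The ballot inequality needs checking only where a D has just been read:
for [c <= 1] it is automatic after a U. *)
Lemma ballot_word_of c (A : pred nat) n : c <= 1 ->
  reflect (forall m, 0 < m <= n -> A m -> 2 * count A (iota 1 m) + c <= m)
          (ballot c (word_of A n)).
Proof.
move=> hc.
have step m : count A (iota 1 m.+1) = count A (iota 1 m) + A m.+1.
  by rewrite iota1S -cats1 count_cat /= addn0.
apply: (@iffP (forall m, 0 < m <= n -> 2 * count A (iota 1 m) + c <= m)).
- elim: n => [|n IHn]; first by left=> m; lia.
  rewrite /= -[(_ + count id _)%N]/(count id (word_of A n.+1)) count_word_of.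
  rewrite size_word_of; apply: (iffP andP) => [[hn /IHn h] m hm | h].
    by case: (ltnP m n.+1) => hmn; [apply: h; lia | have -> : m = n.+1 by lia].
  by split; [apply: h; lia | apply/IHn => m hm; apply: h; lia].
- by move=> h m hm _; apply: h.
move=> h; elim=> // m IHm hm; case Am: (A m.+1); first exact: h.
rewrite step Am addn0; case: m IHm {Am} hm => [|m] IHm hm; first by rewrite /=; lia.
by have := IHm; lia.
Qed.

Lemma nth_le_count s j m : sorted ltn s -> j < size s ->
  (nth 0 s j <= m) = (j < count (fun x => x <= m) s).
Proof.
elim: s j => // x s IHs j hs hj /=.
have {}IHs i := IHs i (path_sorted hs).
case: (leqP x m) => hx; first by case: j hj => // j hj; rewrite add1n ltnS -IHs.
have {}hs : all (ltn x) s by apply: order_path_min hs; apply: ltn_trans.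
rewrite add0n (eq_in_count (a2 := pred0)) ?count_pred0 => [|y /(allP hs) /=]; last lia.
case: j hj => [|j] hj /=; first lia.
by have /= := allP hs _ (mem_nth 0 (hj : j < size s)); lia.
Qed.

Lemma count_le_nth s j : sorted ltn s -> j < size s ->
  count (fun x => x <= nth 0 s j) s = j.+1.
Proof.
move=> hs hj; apply/eqP; rewrite eqn_leq; apply/andP; split; last first.
  by rewrite -nth_le_count.
rewrite leqNgt; apply/negP => h.
have hj' : j.+1 < size s by apply: leq_trans h _; apply: count_size.
by move: h; rewrite -nth_le_count // leqNgt nth_ltn_mono ?inE ?ltnSn.
Qed.

Section Rows.

Variables (n : nat) (r1 r2 : seq nat).
Hypotheses (r12 : perm_eq (r1 ++ r2) (iota 1 n)).
Hypotheses (s1 : sorted ltn r1) (s2 : sorted ltn r2).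

Let A : pred nat := fun m => m \in r2.

Lemma mem_rows m : (m \in r1) || (m \in r2) = (0 < m <= n).
Proof. by rewrite -mem_cat (perm_mem r12) mem_iota add1n ltnS. Qed.

Lemma mem_row1 m : (m \in r1) = (0 < m <= n) && ~~ A m.
Proof.
have := perm_uniq r12; rewrite iota_uniq cat_uniq => /and3P[_ /hasPn dis _].
rewrite -mem_rows /A; case E: (m \in r2); last by rewrite orbF andbT.
by rewrite andbF; apply/negbTE/dis.
Qed.

Lemma row_filter : r2 = [seq m <- iota 1 n | A m] /\ r1 = [seq m <- iota 1 n | ~~ A m].
Proof.
have si p : sorted ltn [seq m <- iota 1 n | p m].
  by apply: sorted_filter; [apply: ltn_trans | apply: iota_ltn_sorted].
split; apply: (irr_sorted_eq ltn_trans ltnn) => // m; rewrite mem_filter mem_iota.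
  by rewrite /A; have := mem_rows m; case: (m \in r2); rewrite ?orbT ?andbF //; lia.
by rewrite mem_row1 andbC; congr (_ && _); lia.
Qed.

Lemma count_rows m : m <= n ->
  count (fun x => x <= m) r2 = count A (iota 1 m) /\
  count (fun x => x <= m) r1 + count A (iota 1 m) = m.
Proof.
move=> hm.
have ci p : count (fun x => x <= m) [seq x <- iota 1 n | p x] = count p (iota 1 m).
  rewrite count_filter -(subnKC hm) iotaD count_cat.
  rewrite [X in _ + X](eq_in_count (a2 := pred0)) ?count_pred0 ?addn0.
    by apply: eq_in_count => x; rewrite mem_iota /= => hx; have -> : x <= m by lia.
  by move=> x; rewrite mem_iota /= => hx; rewrite leqNgt; have -> : m < x by lia.
have [E2 E1] := row_filter; rewrite {1}E2 {1}E1 !ci; split=> //.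
by rewrite addnC count_predC size_iota.
Qed.

Lemma row2_pos j : j < size r2 -> 0 < nth 0 r2 j <= n.
Proof. by move=> hj; rewrite -mem_rows mem_nth ?orbT. Qed.

Lemma count_row2 j : j < size r2 -> count A (iota 1 (nth 0 r2 j)) = j.+1.
Proof.
move=> hj; have /andP[_ hn] := row2_pos hj.
by have [<- _] := count_rows hn; rewrite count_le_nth.
Qed.

(** The entry [d = nth 0 r2 j] is preceded by [d - j.+1] entries of the first
row, so comparing it with an entry of that row compares [d] with a count. The
shift [c = 1] is the comparison made by the cyclic descent condition. *)
Lemma column_lt j c : j < size r2 -> j + c < size r1 ->
  (nth 0 r1 (j + c) < nth 0 r2 j) = (2 * j.+1 + c <= nth 0 r2 j).
Proof.
move=> hj hjc; have /andP[_ hn] := row2_pos hj.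
have [_] := count_rows hn; rewrite count_row2 // => E.
have := nth_le_count (nth 0 r2 j) s1 hjc.
have : nth 0 r1 (j + c) != nth 0 r2 j.
  apply/eqP => E'; have := mem_nth 0 hjc.
  by rewrite E' mem_row1 /A mem_nth // andbF.
lia.
Qed.

Lemma ballot_rows c p : c <= 1 -> p <= n ->
  reflect (forall j, j < size r2 -> nth 0 r2 j <= p -> 2 * j.+1 + c <= nth 0 r2 j)
          (ballot c (word_of A p)).
Proof.
move=> hc hp; apply: (iffP (ballot_word_of A p hc)) => h.
  move=> j hj hjp; rewrite -(count_row2 hj); apply: h; last exact: mem_nth.
  by have := row2_pos hj; lia.
move=> m hm /(nthP 0)[j hj Em]; rewrite -Em count_row2 //; apply: h => //.
by rewrite Em; case/andP: hm.
Qed.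

Lemma ballot0_rows : size r2 <= size r1 ->
  reflect (forall j, j < size r2 -> nth 0 r1 j < nth 0 r2 j) (ballot 0 (word_of A n)).
Proof.
move=> h21; have col j : j < size r2 ->
    (nth 0 r1 j < nth 0 r2 j) = (2 * j.+1 + 0 <= nth 0 r2 j).
  by move=> hj; rewrite -column_lt ?addn0 // (leq_trans hj).
apply: (iffP (@ballot_rows 0 n isT (leqnn n))) => h j hj; last by rewrite -col ?h.
by rewrite col // h //; case/andP: (row2_pos hj).
Qed.

(** Strips the letters U after the last D, which is at [p]. *)
Lemma cyclic_word_of p : 0 < p <= n -> A p -> (forall m, p < m <= n -> ~~ A m) ->
  cyclic_word (word_of A n) = A p.-1 && ballot 1 (word_of A p.-1).
Proof.
move=> hp Ap hA; have A0 : A 0 = false.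
  by apply/negbTE/negP => h0; have := mem_rows 0; rewrite [0 \in r2]h0 orbT.
have -> : n = (n - p) + p by lia.
have : n - p <= n - p by []; elim: {1 3}(n - p) => [_|e IHe he].
  by case: p hp Ap {hA} => // -[|p] _ Ap; rewrite [word_of _ _]/= Ap //= A0.
by rewrite addSn /= (negPf (hA _ _)) ?IHe; lia.
Qed.

(** The second condition stops at [j < k], whereas the strict ballot condition
also concerns the D at [nth 0 r2 k]. There it follows from the ballot
inequality at the next letter, which is a D as well. *)
Lemma cyclic_word_rows k : size r2 = k.+2 -> k.+2 <= size r1 ->
  ballot 0 (word_of A n) ->
  reflect (nth 0 r2 k.+1 = (nth 0 r2 k).+1 /\
           forall j, j < k -> nth 0 r1 j.+1 < nth 0 r2 j)
          (cyclic_word (word_of A n)).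
Proof.
move=> z2 z1 /(@ballot_rows 0 n isT (leqnn n)) b0.
set p := nth 0 r2 k.+1.
have mono := nth_ltn_mono s2.
have hp : 0 < p <= n by apply: row2_pos; rewrite z2.
have Ap : A p by apply: mem_nth; rewrite z2.
have kp : nth 0 r2 k < p by rewrite mono ?inE ?z2.
rewrite (cyclic_word_of hp Ap); last first.
  move=> m /andP[hm _]; apply/negP => /(nthP 0)[l hl E].
  by move: hm; rewrite -E mono ?inE // ?z2 // ltnNge -ltnS -z2 hl.
have eqA : A p.-1 = (p == (nth 0 r2 k).+1).
  apply/idP/eqP => [/(nthP 0)[l hl E] | ->]; last by rewrite /A mem_nth ?z2.
  have lk : l < k.+1 by rewrite -mono ?inE // ?z2 // E prednK; case/andP: hp.
  have : ~~ (nth 0 r2 k < nth 0 r2 l) by rewrite mono ?inE ?z2 //; lia.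
  by rewrite E -/p; lia.
have hp1 : p.-1 <= n by lia.
rewrite eqA; apply: (iffP andP) => [[/eqP E /(@ballot_rows 1 _ isT hp1) b1] | [E h]].
  split=> // j hj; rewrite -[j.+1]addn1 column_lt; [|lia..].
  apply: b1; first lia.
  have : nth 0 r2 j < nth 0 r2 k by rewrite mono ?inE // z2; lia.
  by rewrite E; lia.
split; [by apply/eqP | apply/ballot_rows => //].
move=> j hj hjp; case: (ltnP j k) => hjk.
  by rewrite -column_lt ?addn1 ?h //; lia.
have [Ej | Ej] : j = k \/ j = k.+1 by lia.
  by have := b0 k.+1; rewrite -/p z2 Ej; lia.
by move: hjp; rewrite Ej -/p; lia.
Qed.

End Rows.

Definition marks n (J : {set 'I_n.+1}) : seq nat := [seq val x | x <- enum J].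

Lemma mem_marks n (J : {set 'I_n.+1}) m :
  (m \in marks J) = (m < n.+1) && (inord m \in J).
Proof.
apply/mapP/andP => [[x] | [hm mJ]].
  by rewrite mem_enum => xJ ->; rewrite ltn_ord inord_val.
by exists (inord m); rewrite ?mem_enum //= inordK.
Qed.

Local Notation row := Defs.row.

Section Tableaux.

Variables n k : nat.
Hypothesis hkn : 2 * k <= n.
Implicit Type T : tableau n k.

Definition tableau_word T := word_of (fun m => m \in row T 2) n.

Lemma size_rows T : size (row T 1) = n - k /\ size (row T 2) = k.
Proof. by rewrite !size_map !size_tuple. Qed.

Lemma SYTP T : reflect
  [/\ perm_eq (row T 1 ++ row T 2) (iota 1 n), sorted ltn (row T 1),
      sorted ltn (row T 2) & ballot 0 (tableau_word T)] (T \in SYT n k).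
Proof.
have [z1 z2] := size_rows T.
have col : perm_eq (row T 1 ++ row T 2) (iota 1 n) -> sorted ltn (row T 1) ->
    sorted ltn (row T 2) -> ballot 0 (tableau_word T) =
    [forall j : 'I_k.+1,
           (0 < j <= n - k) && (j <= k) ==> (entry T 1 j < entry T 2 j)].
  move=> hp h1 h2; have hz : size (row T 2) <= size (row T 1) by lia.
  apply/(ballot0_rows hp h1 h2 hz)/forallP => [h j | h j hj].
    by apply/implyP => hj; apply: h; lia.
  have hj' : j.+1 < k.+1 by lia.
  by apply: (implyP (h (Ordinal hj'))) => /=; lia.
rewrite inE; apply: (iffP and4P) => [] [hp h1 h2 h]; split=> //.
  by rewrite col.
by rewrite -col.
Qed.

Lemma tableau_word_inj : {in SYT n k &, injective tableau_word}.
Proof.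
move=> T T' /SYTP[hp h1 h2 _] /SYTP[hp' h1' h2' _] /word_of_inj E.
have [E2 E1] := row_filter hp h1 h2; have [E2' E1'] := row_filter hp' h1' h2'.
have e2 : row T 2 = row T' 2 by rewrite E2 E2'; apply: eq_in_filter => m /E.
have e1 : row T 1 = row T' 1.
  by rewrite E1 E1'; apply: eq_in_filter => m /E ->.
case: T T' e1 e2 {hp h1 h2 hp' h1' h2' E E1 E2 E1' E2'} => [a b] [a' b'].
by rewrite /row /= => /(inj_map val_inj)/val_inj -> /(inj_map val_inj)/val_inj ->.
Qed.

Lemma tuple_of_seq m (s : seq nat) : size s = m -> all (leq^~ n) s ->
  exists t : m.-tuple 'I_n.+1, [seq val x | x <- t] = s.
Proof.
move=> hs hn; have hs' : size (map (@inord n) s) == m by rewrite size_map hs.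
exists (Tuple hs'); rewrite /= -map_comp -[RHS]map_id.
by apply/eq_in_map => x /(allP hn) hx; rewrite /= inordK.
Qed.

Lemma tableau_word_surj u : size u = n -> ballot 0 u -> count id u = k ->
  exists2 T, T \in SYT n k & tableau_word T = u.
Proof.
have [A ->] := word_of_surj u; rewrite size_word_of => -> bu.
rewrite count_word_of => hk.
have le p : all (leq^~ n) [seq m <- iota 1 n | p m].
  by apply/allP => m; rewrite mem_filter mem_iota; lia.
have si p : sorted ltn [seq m <- iota 1 n | p m].
  by apply: sorted_filter; [apply: ltn_trans | apply: iota_ltn_sorted].
have z1 : size [seq m <- iota 1 n | ~~ A m] = n - k.
  by rewrite size_filter -[n in RHS](size_iota 1 n) -hk -(count_predC A) addKn.
have z2 : size [seq m <- iota 1 n | A m] = k by rewrite size_filter.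
have [t1 E1] := tuple_of_seq z1 (le _); have [t2 E2] := tuple_of_seq z2 (le _).
have Ew : tableau_word (t1, t2) = word_of A n.
  rewrite /tableau_word /row /= E2.
  have : n <= n by []; elim: {1 4 5}n => //= m IHm hm.
  rewrite IHm 1?ltnW // mem_filter mem_iota /=; congr (_ :: _).
  by case: (A _) => //=; lia.
exists (t1, t2) => //; apply/SYTP; rewrite Ew /row /= E1 E2; split=> //.
by rewrite perm_catC; apply/permPl/perm_filterC.
Qed.

Lemma card_SYT_words (P : pred bitseq) :
  #|[set T in SYT n k | P (tableau_word T)]| =
  count (fun u => [&& P u, ballot 0 u & count id u == k]) (words n).
Proof.
rewrite cardE -size_filter -(size_map tableau_word); apply/perm_size/uniq_perm.
- rewrite map_inj_in_uniq ?enum_uniq // => T T'.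
  rewrite !mem_enum !inE => /andP[hT _] /andP[hT' _].
  by apply: tableau_word_inj; rewrite ?inE.
- exact/filter_uniq/uniq_words.
move=> u; rewrite mem_filter mem_words; apply/mapP/andP.
  case=> T; rewrite mem_enum inE => /andP[/SYTP[hp h1 h2 hb] hP] ->.
  rewrite hP hb size_word_of eqxx count_word_of -size_filter.
  by have [<- _] := row_filter hp h1 h2; have [_ ->] := size_rows T; rewrite /= eqxx.
case=> /and3P[hP hb /eqP hk] /eqP hs; have [T hT E] := tableau_word_surj hs hb hk.
by exists T => //; rewrite mem_enum inE hT E.
Qed.

Lemma n_is_cdes_word T : 2 <= k -> T \in SYT n k ->
  n_is_cdes T = cyclic_word (tableau_word T).
Proof.
move=> hk /SYTP[hp h1 h2 hb]; have [z1 z2] := size_rows T.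
have Ek : k.-1 = k.-2.+1 by lia.
have z2' : size (row T 2) = k.-2.+2 by lia.
have z1' : k.-2.+2 <= size (row T 1) by lia.
apply/idP/(cyclic_word_rows hp h1 h2 z2' z1' hb) => [/andP[/eqP E /forallP h] | [E h]].
  move: E; rewrite /entry addn1 => E; split; first by rewrite -Ek.
  move=> j hj; have hj' : j.+2 < k by lia.
  exact: (implyP (h (Ordinal hj'))).
apply/andP; split; first by rewrite /entry addn1 -E Ek.
apply/forallP => -[[|[|j]] hj] //=; apply: h; lia.
Qed.

Lemma cDes_word T (J : {set 'I_n.+1}) : 2 <= k -> J \subset brk n ->
  T \in SYT n k ->
  (cDes T == J) =
  descents_at (fun m => m \in marks J) (tableau_word T) &&
  (cyclic_word (tableau_word T) == (n \in marks J)).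
Proof.
move=> hk hJ hT; rewrite -n_is_cdes_word //.
have /SYTP[hp h1 h2 _] := hT.
have hDes (i : 'I_n.+1) : (i \in Des T) =
    [&& 0 < i < n, (i : nat) \notin row T 2 & i.+1 \in row T 2 ].
  rewrite inE; case: (boolP (0 < i < n)) => //= hi.
  rewrite /row_of !(mem_row1 hp).
  have -> : 0 < i <= n by lia.
  have -> : 0 < i.+1 <= n by lia.
  by case: (_ \in _); case: (_ \in _).
have mJ (x : 'I_n.+1) : ((x : nat) \in marks J) = (x \in J).
  by rewrite mem_marks ltn_ord inord_val.
apply/idP/andP => [/eqP EJ | [/descents_at_word_of hd /eqP hc]].
  split.
    apply/descents_at_word_of => m hm; have hm' : m < n.+1 by lia.
    rewrite (mJ (Ordinal hm')) -EJ inE hDes /= hm /=.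
    case: (n_is_cdes T); rewrite inE ?orbF // -val_eqE /=.
    by rewrite [m == n]ltn_eqF ?orbF //; case/andP: hm.
  rewrite (mJ ord_max) -EJ inE hDes /= ltnn andbF /=.
  by case: (n_is_cdes T); rewrite inE ?eqxx.
apply/eqP/setP => i; rewrite inE hDes -mJ.
have [i0 | hi0] := posnP (i : nat).
  have -> : ((i : nat) \in marks J) = false.
    rewrite mJ; apply/negbTE/negP => /(subsetP hJ); rewrite inE i0 //.
  rewrite i0 /= hc; case: (_ \in marks J); rewrite inE // -val_eqE /= i0.
  by rewrite ltn_eqF; lia.
have := ltn_ord i; rewrite ltnS leq_eqVlt => /orP[/eqP En | hi].
  rewrite En ltnn andbF /= -hc; case: (n_is_cdes T); rewrite inE //.
  by rewrite -val_eqE /= En eqxx.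
rewrite -hd ?hi0 //= hi; case: (n_is_cdes T); rewrite inE ?orbF //.
by rewrite -val_eqE /= ltn_eqF ?orbF.
Qed.

End Tableaux.

Local Open Scope ring_scope.

(** * Counting ballot words by a transfer recursion *)

(** The generating functions, by number of D, of the words of length [m.+1]
that end in U and in D respectively and have descents exactly at the positions
of [J] between 1 and [m]. The initial state [s] describes the first letter:
[(1, 'X)] leaves it free and [(0, 'X)] makes it a D. *)
Fixpoint transfer (J : pred nat) m (s : {poly int} * {poly int}) :=
  if m is m'.+1 then
    let: (U, D) := transfer J m' s in
    if J m then (0, 'X * U) else (U + D, 'X * D)
  else s.

Lemma transferS J m s : transfer J m.+1 s =
  if J m.+1 then (0, 'X * (transfer J m s).1)
  else ((transfer J m s).1 + (transfer J m s).2, 'X * (transfer J m s).2).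
Proof. by rewrite /=; case: (transfer J m s). Qed.

Definition word_poly J m : {poly int} :=
  (transfer J m (1, 'X)).1 + (transfer J m (1, 'X)).2.

(** The palindromic symmetry holds for words of free last letter and, in one
degree less, for words ending in U; the two statements are proved together
because each step of the recursion uses both. *)
Lemma transfer_palindrome J m (U := (transfer J m (1, 'X)).1) :
  [/\ forall r, (m < r)%N -> U`_r = 0,
      forall r s, (r + s)%N = m -> U`_r = U`_s,
      forall r, (m.+1 < r)%N -> (word_poly J m)`_r = 0
    & forall r s, (r + s)%N = m.+1 -> (word_poly J m)`_r = (word_poly J m)`_s].
Proof.
rewrite {}/U; elim: m => [|m [IU0 IU IW0 IW]].
  rewrite /word_poly /=; split.
  - by move=> [] // r _; rewrite coef1.
  - by move=> [|r] [|s].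
  - by move=> [|[|r]] // _; rewrite coefD coef1 coefX.
  - by move=> [|[|r]] [|[|s]] //; rewrite !coefD !coef1 !coefX.
set W := word_poly J m in IW0 IW.
have EU : (transfer J m.+1 (1, 'X)).1 = if J m.+1 then 0 else W.
  by rewrite transferS; case: (J _).
have EW : word_poly J m.+1 = if J m.+1 then 'X * (transfer J m (1, 'X)).1
    else W + 'X * (W - (transfer J m (1, 'X)).1).
  by rewrite /word_poly transferS /W /word_poly; case: (J _); rewrite /= ?add0r //; ring.
rewrite EU EW; move: {EU EW} W IW0 IW => W IW0 IW; case: (J _).
  split=> [r _ | r s _ | [|r] hr | [|r] [|s]]; rewrite ?coefC ?if_same ?coefXM //=.
  - by apply: IU0; lia.
  - by move=> h; rewrite IU0 //; lia.
  - by move=> h; rewrite IU0 //; lia.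
  - by move=> h; apply: IU; lia.
split => //.
  move=> [|r] hr //; rewrite coefD coefXM /= coefB IW0 ?IW0 ?IU0 //; lia.
move=> [|r] [|s] h; rewrite !coefD !coefXM //= ?coefB ?addr0.
- rewrite [RHS]addrA (IW0 s.+1) ?IU0; [|lia..].
  by rewrite add0r subr0; apply: IW; lia.
- rewrite [LHS]addrA (IW0 r.+1) ?IU0; [|lia..].
  by rewrite /= ?add0r subr0; apply: IW; lia.
rewrite (IU r s) ?(IW r.+1 s) ?(IW r s.+1); [|lia..]; ring.
Qed.

(** The reflection principle for words with prescribed descents. Words ending
in U need the companion statement in the smaller range [2 * r <= m], since
removing their last letter leaves a word of length [m]. *)
Lemma num_ballots_transfer J m :
  (forall r, (2 * r <= m)%N ->
     (num_ballots J m.+1 false r)%:Z = ((1 - 'X) * (transfer J m (1, 'X)).1)`_r) /\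
  (forall r, (2 * r <= m.+1)%N ->
     (num_ballots J m.+1 false r + num_ballots J m.+1 true r)%:Z
       = ((1 - 'X) * word_poly J m)`_r).
Proof.
elim: m => [|m [IU IW]].
  rewrite /word_poly; split=> -[|r] //; try lia.
  - by rewrite mulr1 coefB coef1 coefX.
  - by move=> _; rewrite mulrBl mul1r coefB coefXM coefD coef1 coefX.
have EU r : (2 * r <= m.+1)%N ->
    (num_ballots J m.+2 false r)%:Z = ((1 - 'X) * (transfer J m.+1 (1, 'X)).1)`_r.
  move=> hr; rewrite num_ballots_upperS transferS.
  case: (J _); first by rewrite mulr0 coef0.
  by rewrite IW.
split=> // -[|r] hr.
  rewrite PoszD EU // num_ballots_lower0 addr0 /word_poly mulrDr coefD transferS.
  by case: (J _); rewrite /= mulrCA coefXM addr0.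
rewrite num_ballots_lowerS hr PoszD num_ballots_upperS.
rewrite /word_poly transferS; case EJ: (J _) => /=.
  by rewrite !add0r mulrCA coefXM /= IU //; lia.
set U := (_ J m _).1; set D := (_ J m _).2.
have -> : (1 - 'X) * (U + D + 'X * D) = (1 - 'X) * (U + D)
   + 'X * ((1 - 'X) * (U + D) - (1 - 'X) * U) by ring.
rewrite coefD coefXM /= coefB -IU; last lia.
rewrite -/(word_poly J m) -IW; last lia.
(* Beyond this range [2 * r.+1 = m.+2]: the ballot words vanish, and the two
   coefficients of [word_poly J m] are symmetric to each other. *)
case: (leqP (2 * r.+1) m.+1) => hr'.
  by rewrite -IW //; rewrite !PoszD; ring.
have [_ _ _ pal] := transfer_palindrome J m.
have -> : ((1 - 'X) * word_poly J m)`_r.+1 = 0.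
  rewrite mulrBl mul1r coefB coefXM /= (pal r.+1 r) ?subrr //; lia.
suff big : forall h, num_ballots J m.+1 h r.+1 = 0%N by rewrite !big !PoszD; ring.
move=> h; apply/eqP; rewrite -leqn0 leqNgt -has_count; apply/hasPn => u.
rewrite mem_words => /eqP su; apply/negP => /and4P[_ _ /ballot_count hb /eqP hc].
by have := hb; rewrite -size_eq0 su hc => /(_ isT); lia.
Qed.

(** * The product over cyclic differences *)

(** Counts the blocks D..DU..U of length [d] with both parts nonempty. *)
Definition block_poly (d : nat) : {poly int} := \sum_(1 <= j < d) 'X^j.

Lemma block_poly1 : block_poly 1 = 0.
Proof. by rewrite /block_poly big_geq. Qed.

Lemma block_polyS d : block_poly d.+2 = 'X + 'X * block_poly d.+1.
Proof.
rewrite /block_poly big_add1 big_nat_recl // expr1 big_add1 big_distrr /=.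
by congr (_ + _); apply: eq_bigr => i _; rewrite -exprS.
Qed.

Lemma block_poly_recr d : block_poly d.+2 = block_poly d.+1 + 'X^(d.+1).
Proof. by rewrite /block_poly big_nat_recr. Qed.

(** Without descents, the only way to pass from D to U is one switch at some
point of the run. The factor ['X] avoids dividing [block_poly] by it. *)
Lemma transfer_free (J : pred nat) m e s (t := transfer J m s) :
  (forall i, (m < i <= m + e)%N -> ~~ J i) ->
  ('X * (transfer J (m + e) s).1 = 'X * t.1 + block_poly e.+1 * t.2) /\
  (transfer J (m + e) s).2 = 'X^e * t.2.
Proof.
elim: e => [|e IHe] hJ.
  by rewrite addn0 /block_poly big_geq // mul0r addr0 mul1r.
have [|IU ID] := IHe; first by move=> i hi; apply: hJ; lia.
rewrite addnS transferS ifN /=; last by apply: hJ; lia.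
by rewrite block_poly_recr mulrDr IU ID exprS; split; ring.
Qed.

Lemma polyXI (p q : {poly int}) : 'X * p = 'X * q -> p = q.
Proof. by move/mulfI; apply; rewrite polyX_eq0. Qed.

(** A descent forgets all but the number of words: it forces U at [p] and D at
[p.+1], and U at [q] then closes a block of length [q - p]. This is why the
count factors. *)
Lemma transfer_gap (J : pred nat) p q s : (0 < p < q)%N -> J p ->
  (forall i, (p < i < q)%N -> ~~ J i) ->
  (transfer J q.-1 s).1 = block_poly (q - p) * (transfer J p.-1 s).1.
Proof.
case: p => // p /andP[_ pq] Jp hJ.
have -> : q.-1 = (p.+1 + (q.-1 - p.+1))%N by lia.
have [|+ _] := @transfer_free J p.+1 (q.-1 - p.+1) s.
  by move=> i hi; apply: hJ; lia.
rewrite transferS Jp /= => E; apply: polyXI; rewrite E.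
have -> : (q.-1 - p.+1).+1 = (q - p.+1)%N by lia.
by ring.
Qed.

Lemma transfer_chain (js : seq nat) s i : sorted ltn js -> 0%N \notin js ->
  (i < size js)%N ->
  (transfer (fun m => m \in js) (nth 0%N js i).-1 s).1 =
  (transfer (fun m => m \in js) (nth 0%N js 0).-1 s).1 *
  \prod_(1 <= l < i.+1) block_poly (nth 0%N js l - nth 0%N js l.-1).
Proof.
move=> js_sorted js0; elim: i => [|i IHi] hi.
  by rewrite big_geq // mulr1.
rewrite big_nat_recr //= mulrA -IHi; last lia.
have mono := nth_ltn_mono js_sorted.
rewrite [RHS]mulrC; apply: transfer_gap.
- apply/andP; split; last by rewrite mono ?inE //; lia.
  rewrite lt0n; apply: contra js0 => /eqP<-; by rewrite mem_nth // ltnW.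
- by rewrite mem_nth // ltnW.
move=> x /andP[lt_ix lt_xi]; apply/negP => /(nthP 0%N)[l hl E].
by move: lt_ix lt_xi; rewrite -E !mono ?inE //; lia.
Qed.

Lemma transfer_first (js : seq nat) s : sorted ltn js -> (0 < nth 0%N js 0)%N ->
  'X * (transfer (fun m => m \in js) (nth 0%N js 0).-1 s).1
     = 'X * s.1 + block_poly (nth 0%N js 0) * s.2.
Proof.
move=> js_sorted hj.
have [|+ _] := @transfer_free (fun m => m \in js) 0 (nth 0%N js 0).-1 s.
  move=> i hi; apply/negP => /(nthP 0%N)[l hl E].
  have := nth_ltn_mono js_sorted; rewrite /prop_in2 => mono.
  have : (nth 0%N js l < nth 0%N js 0)%N by rewrite E; lia.
  by rewrite mono ?inE //; apply: leq_ltn_trans hl.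
by rewrite !add0n => ->; rewrite prednK.
Qed.

Section CyclicDifferences.

Variables (n : nat) (J : {set 'I_n.+1}).

Lemma cdiff_poly_marks : (0 < #|J|)%N ->
  cdiff_poly J = block_poly (nth 0%N (marks J) 0 + n - last 0%N (marks J)) *
    \prod_(1 <= l < (size (marks J)).-1.+1)
      block_poly (nth 0%N (marks J) l - nth 0%N (marks J) l.-1).
Proof.
have sz : size (marks J) = #|J| by rewrite size_map -cardE.
move=> J0; rewrite /cdiff_poly big_ltn //; congr (_ * _).
  by rewrite /cdiff eqxx /elt -sz -/(marks J) nth_last.
rewrite sz prednK // big_add1; apply: eq_big_nat => l hl.
by rewrite /cdiff /elt ifN //; lia.
Qed.

Hypotheses (J0 : (0 < #|J|)%N) (zJ : 0%N \notin marks J).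

Let sz : size (marks J) = #|J|. Proof. by rewrite size_map -cardE. Qed.

Let sorted_marks : sorted ltn (marks J). Proof. exact: enum_set_sorted. Qed.

Let last_marks : last 0%N (marks J) = nth 0%N (marks J) #|J|.-1.
Proof. by rewrite -sz nth_last. Qed.

Let first_gt0 : (0 < nth 0%N (marks J) 0)%N.
Proof.
by rewrite lt0n; apply: contra zJ => /eqP <-; rewrite mem_nth ?sz.
Qed.

Lemma le_last m : m \in marks J -> (m <= last 0%N (marks J))%N.
Proof.
case/(nthP 0%N) => l; rewrite last_marks sz => hl <-.
by rewrite (sorted_leq_nth leq_trans leqnn) ?inE ?sz //;
  [apply: sub_sorted sorted_marks => x y /ltnW | lia | lia].
Qed.

(** When [n] is in [J] no block wraps around: the word starts with a D, ends
with a U and its blocks are those between consecutive elements. *)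
Lemma cdiff_poly_in : n \in marks J ->
  cdiff_poly J = (transfer (fun m => m \in marks J) n.-1 (0, 'X)).1.
Proof.
move=> nJ; have En : last 0%N (marks J) = n.
  apply/eqP; rewrite eqn_leq le_last // andbT.
  have : last 0%N (marks J) \in marks J by rewrite last_marks mem_nth // sz; lia.
  by rewrite mem_marks => /andP[].
rewrite cdiff_poly_marks // En addnK -[X in transfer _ X.-1 _]En last_marks.
rewrite (transfer_chain _ sorted_marks zJ) ?sz; last lia.
by congr (_ * _); apply: polyXI; rewrite transfer_first //= mulr0 add0r mulrC.
Qed.

(** When [n] is not in [J], one block wraps around. Counting it amounts to
counting all words with linear descents at [J] and removing those from D to U,
which would have a cyclic descent at [n]. *)
Lemma cdiff_poly_notin : n \notin marks J ->
  cdiff_poly J =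
    word_poly (fun m => m \in marks J) n.-1
    - (transfer (fun m => m \in marks J) n.-1 (0, 'X)).1.
Proof.
move=> nJ; rewrite cdiff_poly_marks //.
set j := nth _ _ 0; set l := last _ _; set P := \prod_(_ <= _ < _) _.
have lJ : l \in marks J by rewrite /l last_marks mem_nth // sz; lia.
have l0 : (0 < l)%N by rewrite lt0n; apply: contra zJ => /eqP <-.
have jl : (j <= l)%N by apply: le_last; rewrite mem_nth // sz.
have ln : (l < n)%N.
  move: lJ (lJ); rewrite {1}mem_marks => /andP[+ _].
  by rewrite ltnS leq_eqVlt => /orP[/eqP->|//]; rewrite (negPf nJ).
have free s : ('X * (transfer (fun m => m \in marks J) n.-1 s).1
      = block_poly (n - l) * 'X * (transfer (fun m => m \in marks J) l.-1 s).1) /\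
    ((transfer (fun m => m \in marks J) n.-1 s).2
      = 'X^(n - l) * (transfer (fun m => m \in marks J) l.-1 s).1).
  have [|] := @transfer_free (fun m => m \in marks J) l (n.-1 - l) s.
    by move=> i hi; apply/negP => /le_last; rewrite -/l; lia.
  have -> : (l + (n.-1 - l) = n.-1)%N by lia.
  case: l l0 lJ ln {jl} => // l _ lJ ln.
  rewrite transferS lJ /= => -> ->; rewrite mulr0 add0r.
  have -> : (n - l.+1 = (n.-1 - l.+1).+1)%N by lia.
  by rewrite mulrA exprSr mulrA.
have [EU ED] := free (1, 'X); have [EU0 _] := free (0, 'X).
have chain s : (transfer (fun m => m \in marks J) l.-1 s).1
    = (transfer (fun m => m \in marks J) j.-1 s).1 * P.
  by rewrite /l last_marks (transfer_chain _ sorted_marks zJ) /P sz; last lia.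
apply: polyXI; rewrite /word_poly mulrBr mulrDr EU EU0 ED !chain.
have F s := transfer_first s sorted_marks first_gt0.
have -> : 'X * (block_poly (j + n - l) * P) = block_poly (j + n - l) * 'X * P by ring.
have factor (U U0 : {poly int}) :
  block_poly (n - l) * 'X * (U * P) + 'X * ('X^(n - l) * (U * P))
    - block_poly (n - l) * 'X * (U0 * P)
  = (block_poly (n - l) * ('X * U) + 'X^(n - l) * ('X * U)
     - block_poly (n - l) * ('X * U0)) * P by ring.
rewrite factor !F /= -/j; congr (_ * _).
have -> : (j + n - l = (n - l) + j)%N by lia.
have: (0 < n - l)%N by lia.
(* The wrapped block consists of the [n - l] letters after the last descent
   position followed by the first [j] letters. *)
elim: (n - l)%N => // -[_ _|e IHe _].
  move: first_gt0; rewrite -/j; case: (j) => // j' _.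
  by rewrite add1n block_polyS block_poly1 !mul0r expr1; ring.
rewrite addSn.
have -> : block_poly ((e.+1 + j).+1) = 'X + 'X * block_poly (e.+1 + j).
  by rewrite addSn block_polyS.
have -> : ('X + 'X * block_poly (e.+1 + j)) * 'X
    = 'X * 'X + 'X * (block_poly (e.+1 + j) * 'X).
  by ring.
rewrite IHe // [block_poly e.+2]block_polyS ['X^(e.+2)]exprS.
move: (block_poly _) (block_poly j) ('X^_ : {poly int}) => b c p; ring.
Qed.

End CyclicDifferences.

(** After an initial D, not followed by a descent, the second letter is free,
so the recursion restarts there. *)
Lemma transfer_lower_shift J m : (transfer J m.+1 (0, 'X)) =
  if J 1%N then (0, 0) else
  ('X * (transfer (fun i => J i.+1) m (1, 'X)).1,
   'X * (transfer (fun i => J i.+1) m (1, 'X)).2).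
Proof.
elim: m => [|m IHm]; first by rewrite /= mulr0 add0r mulr1; case: (J _).
rewrite transferS IHm transferS; case: (J 1%N) => /=.
  by rewrite mulr0 addr0 if_same.
by case: (J _); rewrite /= ?mulr0 ?mulrDr ?mulrA.
Qed.

(** Words D x U: the inner word x is free, with its descents shifted by 1. *)
Lemma transfer_lower_start J m : (transfer J m.+2 (0, 'X)).1 =
  if J 1%N || J m.+2 then 0 else 'X * word_poly (fun i => J i.+1) m.
Proof.
rewrite transferS transfer_lower_shift /word_poly; case: (J 1%N) => /=.
  by rewrite mulr0 addr0 !if_same.
by case: (J _); rewrite //= mulrDr.
Qed.

(** * Assembling the count *)

Lemma count_ballots J m r : (2 * r <= m.+1)%N ->
  (count (fun u => [&& descents_at J u, ballot 0 u & count id u == r]) (words m.+1))%:Z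
    = ((1 - 'X) * word_poly J m)`_r.
Proof.
move=> hr; have [_ <- //] := num_ballots_transfer J m.
congr Posz; rewrite /num_ballots -count_predUI.
rewrite [X in (_ = _ + X)%N](eq_count (a2 := pred0)).
  by rewrite count_pred0 addn0; apply: eq_count => u /=;
    case: (head _ _); rewrite ?orbF.
by move=> u /=; case: (head _ _); rewrite ?andbF.
Qed.

Lemma count_cyclic_ballots J m r : (2 * r.+2 <= m.+3)%N ->
  (count (fun u => [&& cyclic_word u, descents_at J u, ballot 0 u & count id u == r.+2])
     (words m.+3))%:Z
    = ((1 - 'X) * (transfer J m.+2 (0, 'X)).1)`_r.+2.
Proof.
move=> hr; rewrite count_cyclic_word transfer_lower_start; case: (_ || _).
  by rewrite mulr0 coef0.
by rewrite count_ballots 1?mulrCA ?coefXM //; lia.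
Qed.

Theorem theorem5p13 (n k : nat) (hk2 : (2 <= k)%N) (hkn : (2 * k <= n)%N)
    (J : {set 'I_n.+1}) (hJ0 : set0 \proper J) (hJn : J \proper brk n) :
  (#|[set T in SYT n k | cDes T == J]|)%:Z
  = (cdiff_poly J)`_k - (cdiff_poly J)`_(k - 1).
Proof.
have hJ := proper_sub hJn.
have J0 : (0 < #|J|)%N by move/proper_card: hJ0; rewrite cards0.
have zJ : 0%N \notin marks J.
  rewrite mem_marks /=; apply/negP => /(subsetP hJ).
  by rewrite inE inordK.
have -> : (cdiff_poly J)`_k - (cdiff_poly J)`_(k - 1) = ((1 - 'X) * cdiff_poly J)`_k.
  by rewrite mulrBl mul1r coefB coefXM subn1; case: k hk2 {hkn}.
pose mJ := fun m => m \in marks J.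
pose Q u := descents_at mJ u && (cyclic_word u == (n \in marks J)).
have -> : [set T in SYT n k | cDes T == J] = [set T in SYT n k | Q (tableau_word T)].
  apply/setP => T; rewrite [LHS]in_set [RHS]in_set.
  by case: (boolP (T \in SYT n k)) => //= hT; rewrite cDes_word.
rewrite card_SYT_words //.
pose P u := [&& descents_at mJ u, ballot 0 u & count id u == k].
have all_count : (count P (words n))%:Z = ((1 - 'X) * word_poly mJ n.-1)`_k.
  have n1 : n.-1.+1 = n by lia.
  by have := @count_ballots mJ n.-1 k; rewrite n1; apply.
have cyc_count : (count (predI cyclic_word P) (words n))%:Z
    = ((1 - 'X) * (transfer mJ n.-1 (0, 'X)).1)`_k.
  have n3 : (n - 3).+3 = n by lia.
  have n2 : (n - 3).+2 = n.-1 by lia.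
  have k2 : (k - 2).+2 = k by lia.
  by have := @count_cyclic_ballots mJ (n - 3) (k - 2); rewrite n3 n2 k2; apply.
case: (boolP (n \in marks J)) => nJ.
  rewrite (cdiff_poly_in J0 zJ nJ) -cyc_count; congr Posz.
  by apply: eq_count => u; rewrite /Q /= /P nJ eqb_id -andbA andbCA.
rewrite (cdiff_poly_notin J0 zJ nJ) mulrBr coefB -all_count -cyc_count.
have -> : count P (words n)
    = (count (predI cyclic_word P) (words n)
       + count (predI (predC cyclic_word) P) (words n))%N.
  elim: (words n) => //= u us ->.
  by case: (cyclic_word u); case: (P u); rewrite /=; lia.
rewrite PoszD addrAC subrr add0r; congr Posz.
by apply: eq_count => u; rewrite /Q /= /P (negPf nJ) eqbF_neg -andbA andbCA.
Qed.
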